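(* Let $E$ be a finite set and let $\Gamma$ be a nonempty family of subsets of $E$ such that $|\gamma|=k$ for all $\gamma\in\Gamma$, for some integer $k$ with $0<k<|E|$. Let $\Gamma^*=\{E\setminus\gamma:\gamma\in\Gamma\}$. Let $\widehat\Gamma$ and $\widehat{\Gamma^*}$ be the Fulkerson blocker families of $\Gamma$ and $\Gamma^*$, and let $\eta^*$ and $\eta^*_\circ$ be the optimal densities for $\mathrm{Mod}_2(\widehat\Gamma)$ and $\mathrm{Mod}_2(\widehat{\Gamma^*})$, respectively. Then $\eta^*+\eta^*_\circ=\mathbf 1$, where $\mathbf 1$ is the all-ones vector in $\mathbb R^E$.
   Context: Subsets of $E$ are identified with their indicator vectors. For $\Gamma\subseteq\mathbb R^E_{\ge0}$, $\mathrm{Adm}(\Gamma)=\{\rho\in\mathbb R^E_{\ge0}:\sum_e\gamma(e)\rho(e)\ge1\ \forall\gamma\in\Gamma\}$; the Fulkerson blocker family $\widehat\Gamma$ is the set of extreme points of $\mathrm{Adm}(\Gamma)$. $\mathrm{Mod}_2(\Gamma)=\min\{\sum_{e}\rho(e)^2:\rho\in\mathrm{Adm}(\Gamma)\}$; the minimizer (optimal density) exists and is unique. *)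

(* Defs.v *)
From HB Require Import structures.
From mathcomp Require Import all_boot all_order all_algebra.
From mathcomp Require Import classical_sets reals.

Set Implicit Arguments.
Unset Strict Implicit.
Unset Printing Implicit Defensive.

Import Order.TTheory GRing.Theory Num.Theory.
Local Open Scope classical_set_scope.
Local Open Scope ring_scope.

Definition nonneg_vec (R : realType) (E : finType) (rho : {ffun E -> R}) : Prop :=
  forall e, 0 <= rho e.

Definition Adm (R : realType) (E : finType) (Gamma : set {ffun E -> R}) :
    set {ffun E -> R} :=
  [set rho | nonneg_vec rho /\
     forall gamma, Gamma gamma -> 1 <= \sum_e gamma e * rho e].

Definition extreme_points (R : realType) (E : finType) (K : set {ffun E -> R}) :
    set {ffun E -> R} :=
  [set x | K x /\
     forall (y z : {ffun E -> R}) (t : R), K y -> K z -> 0 < t -> t < 1 ->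
       x = [ffun e => t * y e + (1 - t) * z e] -> y = x /\ z = x].

Definition blocker (R : realType) (E : finType) (Gamma : set {ffun E -> R}) :
    set {ffun E -> R} :=
  extreme_points (Adm Gamma).

Definition energy2 (R : realType) (E : finType) (rho : {ffun E -> R}) : R :=
  \sum_e rho e ^+ 2.

(* rho attains the minimum defining Mod_2(Gamma). *)
Definition optimal_density (R : realType) (E : finType)
    (Gamma : set {ffun E -> R}) (rho : {ffun E -> R}) : Prop :=
  Adm Gamma rho /\ forall rho', Adm Gamma rho' -> energy2 rho <= energy2 rho'.

Definition indicator_vec (R : realType) (E : finType) (A : {set E}) :
    {ffun E -> R} :=
  [ffun e => (e \in A)%:R].

Definition family_vec (R : realType) (E : finType) (G : {set {set E}}) :
    set {ffun E -> R} :=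
  [set v | exists2 A, A \in G & v = indicator_vec R A].
Arguments family_vec R {E} G _.

Definition compl_family (E : finType) (G : {set {set E}}) : {set {set E}} :=
  [set ~: A | A in G]%SET.

(* Main.v *)
Require Import Defs.
From HB Require Import structures.
From mathcomp Require Import all_boot all_order all_algebra.
From mathcomp Require Import ring lra.
From mathcomp Require Import boolp classical_sets reals.

Set Implicit Arguments.
Unset Strict Implicit.
Unset Printing Implicit Defensive.

Import Order.TTheory GRing.Theory Num.Theory.
Local Open Scope ring_scope.

(** Let [P] be the admissible set of the blocker of [Gamma]. A linear cost attains
    its minimum over [Adm Gamma] at an extreme point, so [eta] in [P] satisfies
    [c <= eta . rho] whenever [rho >= 0] has weight at least [c] on every member
    of [Gamma]. An optimal [eta] has total mass [k]: each [e] with [0 < eta e]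
    admits an extreme [rho_e] with [eta . rho_e = 1] and [0 < rho_e e], and
    testing [eta] against the positive part of [\sum_e rho_e - eps] bounds the
    mass from above. Testing [eta] against [M - rho] then shows that [1 - eta]
    lies in the corresponding set for the complements. On vectors of fixed mass
    [eta |-> 1 - eta] shifts the energy by a constant, so by symmetry it
    exchanges the two minimizers, which are unique by strict convexity. *)

(** Yields one step size for finitely many constraints: the minimum of the individual thresholds,
    capped at 1 so that an empty [I] is harmless. *)
Lemma uniform_pos (R : realType) (I : finType) (P : I -> R -> Prop) :
  (forall i d d', P i d -> 0 < d' -> d' <= d -> P i d') ->
  (forall i, exists2 d, 0 < d & P i d) ->
  exists2 d, 0 < d & forall i, P i d.
Proof.
move=> Pdown /fin_all_exists2[f f_gt0 Pf].
have d_gt0 : 0 < \big[Order.min/1]_i f i by apply: lt_bigmin.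
exists (\big[Order.min/1]_i f i) => // i.
by apply: Pdown (Pf i) d_gt0 _; apply: bigmin_le_cond.
Qed.

Section Dot.
Variables (R : realType) (E : finType).
Implicit Types u v w x y d : {ffun E -> R}.

Definition dot u v : R := \sum_e u e * v e.

Lemma dotC u v : dot u v = dot v u.
Proof. by apply: eq_bigr => e _; rewrite mulrC. Qed.

Lemma dot_comb u v w (s t : R) :
  dot u [ffun e => s * v e + t * w e] = s * dot u v + t * dot u w.
Proof.
rewrite /dot !mulr_sumr -big_split; apply: eq_bigr => e _ /=.
by rewrite ffunE; ring.
Qed.

Lemma dot_line u v w (t : R) :
  dot u [ffun e => v e + t * w e] = dot u v + t * dot u w.
Proof.
rewrite /dot mulr_sumr -big_split; apply: eq_bigr => e _ /=.
by rewrite ffunE; ring.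
Qed.

Lemma dot_ge0 u v : nonneg_vec u -> nonneg_vec v -> 0 <= dot u v.
Proof. by move=> u0 v0; apply: sumr_ge0 => e _; apply: mulr_ge0. Qed.

Definition unit_vec e : {ffun E -> R} := [ffun e' => (e' == e)%:R].

Lemma dot_unit_vec e v : dot (unit_vec e) v = v e.
Proof.
rewrite /dot (bigD1 e) //= big1 ?addr0 ?ffunE ?eqxx ?mul1r // => i ie.
by rewrite ffunE (negPf ie) mul0r.
Qed.

End Dot.

(** * Extreme points of a polyhedron cut out by finitely many inequalities *)

Section Polyhedron.
Variables (R : realType) (E I : finType).
Variables (a : I -> {ffun E -> R}) (b : I -> R).
Implicit Types x y d c : {ffun E -> R}.

Definition polyhedron : set {ffun E -> R} :=
  [set x | forall i, b i <= dot (a i) x]%classic.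

Definition tight x : {set I} := [set i | dot (a i) x == b i].

(** The segment from [y] to [x] can be prolonged past [x] to [z = x + s (x - y)]: constraints tight
    at [x] are tight at [y] too, and the others have slack at [x]. Extremality of [x] then forces
    [y = x]. *)
Lemma extreme_tight_inj x y : extreme_points polyhedron x -> polyhedron y ->
  tight x \subset tight y -> y = x.
Proof.
move=> [Kx extx] Ky /fintype.subsetP sub_xy.
have [s s0 Ps] : exists2 s : R, 0 < s & forall i,
    b i <= (1 + s) * dot (a i) x + (- s) * dot (a i) y.
  apply: uniform_pos => [i d d' Pd d'0 d'd|i].
    have := Kx i; have := Ky i; move: Pd.
    case: (lerP (dot (a i) y) (dot (a i) x)) => ?; nra.
  have [xi|xi] := eqVneq (dot (a i) x) (b i).
    have /sub_xy : i \in tight x by rewrite inE xi.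
    rewrite inE => /eqP ->; rewrite xi; exists 1 => //; lra.
  have bx : b i < dot (a i) x by rewrite lt_neqAle eq_sym xi Kx.
  have Kyi := Ky i.
  (* The added 1 keeps the divisor positive when [y] has no slack. *)
  pose q := dot (a i) y - b i + 1.
  have q0 : 0 < q by rewrite /q; lra.
  exists ((dot (a i) x - b i) / q); first by rewrite divr_gt0 // subr_gt0.
  set s := _ / q.
  have sq : s * q = dot (a i) x - b i by rewrite /s divfK // gt_eqF.
  have s0 : 0 <= s by rewrite /s divr_ge0 // ?subr_ge0 ltW.
  move: sq; rewrite /q; nra.
pose z : {ffun E -> R} := [ffun e => (1 + s) * x e + (- s) * y e].
have Kz : polyhedron z by move=> i; rewrite dot_comb.
have s1 : 0 < 1 + s by lra.
have t0 : 0 < s / (1 + s) by rewrite divr_gt0.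
have t1 : s / (1 + s) < 1 by rewrite ltr_pdivrMr //; lra.
suff xE : x = [ffun e => s / (1 + s) * y e + (1 - s / (1 + s)) * z e].
  by case: (extx y z _ Ky Kz t0 t1 xE).
by apply/ffunP => e; rewrite !ffunE; field; rewrite gt_eqF.
Qed.

(** The direction joins the ends of a segment of the polyhedron with [x] in its interior; a
    constraint tight at [x] is tight at both ends. *)
Lemma nonextreme_direction x : polyhedron x -> ~ extreme_points polyhedron x ->
  exists2 d : {ffun E -> R}, exists e, d e != 0 & forall i, i \in tight x -> dot (a i) d = 0.
Proof.
move=> Kx next; apply: contrapT => nd; apply: next; split => // y z t Ky Kz t0 t1 xE.
have yz : y = z.
  apply: contrapT => yz; apply: nd; exists [ffun e => y e + (-1) * z e].
    apply: contrapT => ne; apply: yz; apply/ffunP => e; apply/eqP.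
    rewrite -subr_eq0; apply/negPn/negP => ye; apply: ne; exists e.
    by rewrite ffunE mulN1r.
  move=> i; rewrite inE xE dot_comb dot_line => /eqP Ei.
  by have := Ky i; have := Kz i; nra.
by subst z; split=> //; apply/ffunP => e; rewrite xE !ffunE; ring.
Qed.

(** The ratio test of the simplex method: [s] is the first step at which a constraint decreasing
    along [d] becomes tight. *)
Lemma tighten x d : polyhedron x ->
  (forall i, i \in tight x -> dot (a i) d = 0) -> (exists j, dot (a j) d < 0) ->
  exists2 s, 0 < s & let y := [ffun e => x e + s * d e] in
    polyhedron y /\ tight x \proper tight y.
Proof.
move=> Kx td [j0 dj0].
pose ratio j := (dot (a j) x - b j) / - dot (a j) d.
case: (@arg_minP _ _ _ j0 (fun j => dot (a j) d < 0) ratio dj0) => j dj minj.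
set s := ratio j in minj.
have sE : s * - dot (a j) d = dot (a j) x - b j.
  by rewrite /s /ratio divfK // oppr_eq0 lt_eqF.
have xj : b j < dot (a j) x.
  rewrite lt_neqAle Kx andbT eq_sym; apply/negP => xj.
  by move: dj; rewrite td ?ltxx ?inE.
have s0 : 0 < s by rewrite /s /ratio divr_gt0 ?subr_gt0 // oppr_gt0.
exists s => //; split=> [i|].
  rewrite dot_line; have := Kx i.
  have [di|di] := ltP (dot (a i) d) 0; last by nra.
  have := minj i di; rewrite /ratio ler_pdivlMr ?oppr_gt0 //; lra.
apply/properP; split.
  apply/fintype.subsetP => i xi; move: (xi); rewrite !inE dot_line => /eqP ->.
  by rewrite td // mulr0 addr0.
exists j; rewrite inE ?dot_line; last by rewrite gt_eqF.
by apply/eqP; lra.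
Qed.

(* Among the points of no larger cost, one with the most tight constraints is
   extreme. *)
Lemma extreme_point_le c x :
  (forall d, (exists e, d e != 0) -> exists j, dot (a j) d != 0) ->
  (forall d, (forall j, 0 <= dot (a j) d) -> 0 <= dot c d) ->
  polyhedron x -> exists2 y, extreme_points polyhedron y & dot c y <= dot c x.
Proof.
move=> pointed bounded Kx.
pose Q n := `[< exists y, [/\ polyhedron y, dot c y <= dot c x & #|tight y| = n] >].
have exQ : exists n, Q n by exists #|tight x|; apply/asboolP; exists x.
have Qmax n : Q n -> (n <= #|I|)%N by move=> /asboolP[y [_ _ <-]]; apply: max_card.
case: (ex_maxnP exQ Qmax) => n /asboolP[y [Ky cy yn]] maxn.
exists y => //; apply: contrapT => /(nonextreme_direction Ky)[d dn0 td].
(* Both [d] and [-d] keep the tight constraints; a suitable sign does not raise the cost and makes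
   some constraint decrease. *)
suff [d' [cd' td' jd']] : exists d', [/\ dot c d' <= 0,
    (forall i, i \in tight y -> dot (a i) d' = 0) & exists j, dot (a j) d' < 0].
  have [s s0 [Kz /proper_card]] := tighten Ky td' jd'.
  rewrite yn ltnNge maxn //; apply/asboolP; eexists; split; [exact: Kz| |by []].
  by rewrite dot_line; nra.
have opp u : dot u [ffun e => 0 + (-1) * d e] = - dot u d.
  rewrite /dot -sumrN; apply: eq_bigr => i _; rewrite ffunE; ring.
have [j dj] := pointed d dn0.
have [[i di]|nneg] := pselect (exists i, dot (a i) d < 0).
  have [cd|cd] := leP (dot c d) 0; first by exists d; split=> //; exists i.
  (* If no constraint increases along [d], then [-d] is a recession direction and [bounded]
     contradicts [0 < dot c d]. *)
  have [[l dl]|npos] := pselect (exists l, 0 < dot (a l) d).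
    exists [ffun e => 0 + (-1) * d e]; split; rewrite ?opp; first by lra.
      by move=> m /td dm; rewrite opp dm oppr0.
    by exists l; rewrite opp; lra.
  have := bounded [ffun e => 0 + (-1) * d e]; rewrite opp => H.
  suff : 0 <= - dot c d by lra.
  by apply: H => l; rewrite opp oppr_ge0 leNgt; apply/negP => dl; apply: npos; exists l.
have nneg' l : 0 <= dot (a l) d by rewrite leNgt; apply/negP => dl; apply: nneg; exists l.
exists [ffun e => 0 + (-1) * d e]; split; rewrite ?opp.
- by have := bounded d nneg'; lra.
- by move=> m /td dm; rewrite opp dm oppr0.
- by exists j; rewrite opp oppr_lt0 lt_neqAle eq_sym dj nneg'.
Qed.

End Polyhedron.

(** * Admissible sets, blockers and optimal densities *)

Section Adm.
Variables (R : realType) (E : finType).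
Implicit Types (G : {set {set E}}) (rho eta : {ffun E -> R}).

Lemma dot_indicator (A : {set E}) rho :
  dot (indicator_vec R A) rho = \sum_(e in A) rho e.
Proof.
rewrite /dot [RHS]big_mkcond; apply: eq_bigr => e _.
by rewrite ffunE; case: ifP => _; rewrite ?mul1r ?mul0r.
Qed.

(** Sets outside [G] get the trivial constraint [0 <= 0], so the index type does not depend on
    [G]. *)
Definition adm_row G (i : E + {set E}) : {ffun E -> R} :=
  match i with
  | inl e => unit_vec R e
  | inr A => if A \in G then indicator_vec R A else [ffun=> 0]
  end.

Definition adm_rhs G (i : E + {set E}) : R :=
  match i with inl e => 0 | inr A => (A \in G)%:R end.

Lemma Adm_polyhedron G :
  Adm (family_vec R G) = polyhedron (adm_row G) (adm_rhs G).
Proof.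
apply/seteqP; split=> [rho [rho0 Grho] [e|A]|rho Krho] /=.
- by rewrite dot_unit_vec.
- case: ifP => AG; first by apply: Grho; exists A.
  by rewrite /dot big1 // => e _; rewrite ffunE mul0r.
split=> [e|_ [A AG ->]].
  by have := Krho (inl e); rewrite /= dot_unit_vec.
by have := Krho (inr A); rewrite /= AG.
Qed.

(** This makes the blocker finite: its points are indexed by their tight sets. *)
Lemma blocker_tight_inj G rho rho' :
  blocker (family_vec R G) rho -> blocker (family_vec R G) rho' ->
  tight (adm_row G) (adm_rhs G) rho = tight (adm_row G) (adm_rhs G) rho' ->
  rho' = rho.
Proof.
rewrite /blocker Adm_polyhedron => ext ext' T.
by apply: extreme_tight_inj ext (proj1 ext') _; rewrite T.
Qed.

Lemma blocker_le G c rho : nonneg_vec c -> Adm (family_vec R G) rho ->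
  exists2 rho', blocker (family_vec R G) rho' & dot c rho' <= dot c rho.
Proof.
rewrite /blocker Adm_polyhedron => c0 Krho; apply: extreme_point_le Krho.
  by move=> d [e de]; exists (inl e); rewrite /= dot_unit_vec.
move=> d d0; apply: dot_ge0 => // e.
by have := d0 (inl e); rewrite /= dot_unit_vec.
Qed.

(** For [0 < c], the vector [rho / c] is admissible for [G], so some extreme point costs no more
    against [eta], and its cost is at least 1. *)
Lemma Adm_blocker_ge G eta rho (c : R) :
  Adm (blocker (family_vec R G)) eta -> nonneg_vec rho ->
  (forall A, A \in G -> c <= \sum_(e in A) rho e) -> c <= dot eta rho.
Proof.
move=> [eta0 Beta] rho0 Grho.
have [c0|c0] := leP c 0; first by apply: le_trans c0 _; apply: dot_ge0.
pose rho' : {ffun E -> R} := [ffun e => 0 * rho e + c^-1 * rho e].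
have rho'E u : dot u rho' = c^-1 * dot u rho by rewrite dot_comb mul0r add0r.
have [|sigma Bs] := @blocker_le G eta rho' eta0.
  split=> [e|_ [A AG ->]].
    by rewrite ffunE mul0r add0r mulr_ge0 // invr_ge0 ltW.
  by rewrite -/(dot _ _) rho'E dot_indicator ler_pdivlMl // mulr1 Grho.
have := Beta _ Bs; rewrite -/(dot _ _) dotC rho'E => h1 h2.
by have := le_trans h1 h2; rewrite ler_pdivlMl // mulr1.
Qed.

(** By the parallelogram identity, the admissible midpoint of two distinct minimizers would have
    smaller energy. *)
Lemma optimal_density_unique (Gamma : set {ffun E -> R}) rho rho' :
  optimal_density Gamma rho -> Adm Gamma rho' ->
  energy2 rho' <= energy2 rho -> rho' = rho.
Proof.
move=> [[rho0 Grho] opt] [rho'0 Grho'] le_energy.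
pose m : {ffun E -> R} := [ffun e => 2^-1 * rho e + 2^-1 * rho' e].
have /opt le_m : Adm Gamma m.
  split=> [e|gamma Gg]; first by rewrite ffunE; have := rho0 e; have := rho'0 e; lra.
  by have := Grho _ Gg; have := Grho' _ Gg; rewrite -!/(dot _ _) dot_comb; lra.
have midE : energy2 m + 4^-1 * \sum_e (rho e - rho' e) ^+ 2
    = 2^-1 * energy2 rho + 2^-1 * energy2 rho'.
  rewrite /energy2 !mulr_sumr -!big_split; apply: eq_bigr => e _ /=.
  by rewrite ffunE; field.
have sq_ge0 e : true -> 0 <= (rho e - rho' e) ^+ 2 by rewrite sqr_ge0.
have sum0 : \sum_e (rho e - rho' e) ^+ 2 = 0.
  by apply/eqP; rewrite eq_le sumr_ge0 // andbT; lra.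
apply/ffunP => e; apply/esym/eqP; rewrite -subr_eq0 -sqrf_eq0.
by apply/eqP/(psumr_eq0P sq_ge0 sum0).
Qed.

(* Otherwise, the extreme points being finitely many, the coordinate [eta e]
   could be lowered without leaving [Adm]. *)
Lemma optimal_density_active G eta e :
  optimal_density (blocker (family_vec R G)) eta -> 0 < eta e ->
  exists rho, [/\ blocker (family_vec R G) rho, 0 < rho e & dot eta rho = 1].
Proof.
move=> [[eta0 Beta] opt] eta_e; apply: contrapT => no_active.
have blocker_ge0 rho e' : blocker (family_vec R G) rho -> 0 <= rho e'.
  by case=> -[].
(* Each tight set [T] carries at most one extreme point, so [uniform_pos] over all [T] gives a
   common [s]. *)
have [s s0 Ps] : exists2 s : R, 0 < s &
    forall T rho, blocker (family_vec R G) rho ->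
      tight (adm_row G) (adm_rhs G) rho = T -> 1 <= dot eta rho - s * rho e.
  apply: uniform_pos => [T d d' Pd d'0 d'd rho Brho Trho|T].
    have := Pd rho Brho Trho; have := blocker_ge0 rho e Brho; nra.
  have [[rho [Brho Trho]]|none] := pselect (exists rho,
      blocker (family_vec R G) rho /\ tight (adm_row G) (adm_rhs G) rho = T);
    last by exists 1 => // rho Brho Trho; case: none; exists rho.
  have := Beta _ Brho; rewrite -/(dot _ _) dotC le_eqVlt.
  have := blocker_ge0 rho e Brho; rewrite le_eqVlt.
  have uniq rho' : blocker (family_vec R G) rho' ->
      tight (adm_row G) (adm_rhs G) rho' = T -> rho' = rho.
    by move=> Brho' Trho'; apply: blocker_tight_inj Brho Brho' _; rewrite Trho Trho'.
  move=> /orP[/eqP re0 ge1|re0 /orP[/eqP eq1|gt1]].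
  - exists 1 => // rho' Brho' /(uniq _ Brho') ->.
    by rewrite -re0 mulr0 subr0 le_eqVlt.
  - by case: no_active; exists rho.
  - exists ((dot eta rho - 1) / rho e); first by rewrite divr_gt0 // subr_gt0.
    by move=> rho' Brho' /(uniq _ Brho') ->; rewrite divfK ?gt_eqF //; lra.
(* The bound [s] preserves the constraints, the bound [eta e] nonnegativity. *)
pose t := Order.min s (eta e).
have t0 : 0 < t by rewrite lt_min s0.
have ts : t <= s by rewrite ge_min lexx.
have te : t <= eta e by rewrite ge_min lexx orbT.
pose eta' : {ffun E -> R} := [ffun e' => eta e' + (- t) * unit_vec R e e'].
have /opt : Adm (blocker (family_vec R G)) eta'.
  split=> [e'|rho Brho].
    rewrite !ffunE; have [->|_] := eqVneq e' e; first by rewrite mulr1 subr_ge0.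
    by rewrite mulr0 addr0.
  rewrite -/(dot _ _) dot_line [dot rho (unit_vec _ _)]dotC dot_unit_vec dotC.
  have := Ps _ rho Brho erefl; have := blocker_ge0 rho e Brho; nra.
rewrite /energy2 (bigD1 e) //= [leRHS](bigD1 e) //=.
rewrite [X in _ <= _ + X](eq_bigr (fun i => eta i ^+ 2)) => [|i ie].
  by rewrite lerD2r !ffunE eqxx mulr1; nra.
by rewrite !ffunE (negPf ie) mulr0 addr0.
Qed.

Lemma optimal_density_sum G (k : nat) eta : (0 < k)%N ->
  (forall A, A \in G -> #|A| = k) ->
  optimal_density (blocker (family_vec R G)) eta -> \sum_e eta e = k%:R.
Proof.
move=> k0 cardG opt; have [[eta0 Beta] _] := opt.
have sum_cst (A : {set E}) (c : R) : A \in G -> \sum_(e in A) c = k%:R * c.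
  by move=> AG; rewrite sumr_const cardG // mulr_natl.
apply/eqP; rewrite eq_le; apply/andP; split; last first.
  have -> : \sum_e eta e = dot eta [ffun=> 1].
    by apply: eq_bigr => e _; rewrite ffunE mulr1.
  apply: Adm_blocker_ge (conj eta0 Beta) _ _ => [e|A AG]; first by rewrite ffunE.
  by rewrite (eq_bigr (fun=> 1)) ?sum_cst ?mulr1 // => e _; rewrite ffunE.
have /fin_all_exists[f Pf] : forall e, exists rho, 0 < eta e ->
    [/\ blocker (family_vec R G) rho, 0 < rho e & dot eta rho = 1].
  move=> e; have [/(optimal_density_active opt)[rho Prho]|e0] := ltP 0 (eta e).
    by exists rho.
  by exists [ffun=> 0].
pose S := [set e | 0 < eta e].
pose rho : {ffun E -> R} := [ffun e => \sum_(e' in S) f e' e].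
have f_ge0 e' e : e' \in S -> 0 <= f e' e.
  by rewrite inE => /Pf[[[f0 _] _] _ _].
have [eps eps0 Peps] : exists2 eps : R, 0 < eps &
    forall e, e \in S -> eps <= rho e.
  apply: uniform_pos => [e d d' Pd d'0 d'd /Pd|e]; first exact: le_trans.
  have [eS|eS] := boolP (e \in S); last by exists 1.
  exists (f e e); first by move: (eS); rewrite inE => /Pf[].
  rewrite ffunE (bigD1 e) //= lerDl => _; apply: sumr_ge0 => e' /andP[e'S _].
  exact: f_ge0.
(* By the choice of [eps], truncation at 0 acts only outside [S], where [eta] vanishes. *)
pose rho' : {ffun E -> R} := [ffun e => Order.max (rho e - eps) 0].
have eta_rho' : dot eta rho' = #|S|%:R - eps * \sum_e eta e.
  transitivity (dot eta rho - eps * \sum_e eta e).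
    rewrite /dot mulr_sumr -sumrB; apply: eq_bigr => e _; rewrite ffunE.
    have [eS|] := boolP (e \in S).
      by have := Peps e eS; rewrite -subr_ge0 => /max_idPl ->; ring.
    by rewrite inE lt_neqAle eta0 andbT negbK => /eqP <-; ring.
  congr (_ - _); rewrite /dot.
  under eq_bigr => e _ do rewrite ffunE mulr_sumr.
  rewrite exchange_big /= (eq_bigr (fun=> 1)) ?sumr_const // => e.
  by rewrite inE => /Pf[_ _ <-].
(* Cancelling [#|S|] and dividing by [eps] gives the upper bound on the mass. The weight of [rho] on
   a member is at least [#|S|], one unit from each [f e]. *)
suff : #|S|%:R - k%:R * eps <= dot eta rho' by rewrite eta_rho'; nra.
apply: Adm_blocker_ge (conj eta0 Beta) _ _ => [e|A AG].
  by rewrite ffunE le_max lexx orbT.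
have le_rho' : \sum_(e in A) (rho e - eps) <= \sum_(e in A) rho' e.
  by apply: ler_sum => e _; rewrite [rho' e]ffunE le_max lexx.
apply: le_trans le_rho'; rewrite sumrB sum_cst // lerD2r.
under eq_bigr => e _ do rewrite ffunE.
rewrite exchange_big /= -sumr_const; apply: ler_sum => e.
rewrite inE => /Pf[[[_ Gf] _] _ _].
by rewrite -dot_indicator; apply: Gf; exists A.
Qed.

(** * Passage to complements *)

Definition co_vec eta : {ffun E -> R} := [ffun e => 1 - eta e].

Lemma energy2_co_vec eta :
  energy2 (co_vec eta) = #|E|%:R - 2 * \sum_e eta e + energy2 eta.
Proof.
rewrite -sumr_const /energy2 mulr_sumr -sumrB -big_split.
by apply: eq_bigr => e _ /=; rewrite ffunE; ring.
Qed.

(* An admissible [rho] for the complements is reflected to [M - rho], whose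
   weights on [G] are bounded below. *)
Lemma Adm_blocker_compl G (k : nat) eta : (forall A, A \in G -> #|A| = k) ->
  Adm (blocker (family_vec R G)) eta -> \sum_e eta e = k%:R ->
  Adm (blocker (family_vec R (compl_family G))) (co_vec eta).
Proof.
move=> cardG Beta sum_eta.
(* Since [eta] has mass [k], the terms in [M] cancel. *)
have reflect rho (c : R) : nonneg_vec rho ->
    (forall A, A \in G -> \sum_(e in A) rho e <= c) -> dot eta rho <= c.
  move=> rho0 Grho; pose M := \sum_e rho e.
  have le_M e : rho e <= M.
    by rewrite /M (bigD1 e) //= lerDl; apply: sumr_ge0.
  have : k%:R * M - c <= dot eta [ffun e => M - rho e].
    apply: Adm_blocker_ge Beta _ _ => [e|A AG]; first by rewrite ffunE subr_ge0.
    under eq_bigr => e _ do rewrite ffunE.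
    by rewrite sumrB sumr_const cardG // -[M *+ k]mulr_natl lerD2l lerN2 Grho.
  have -> : dot eta [ffun e => M - rho e] = M * \sum_e eta e - dot eta rho.
    rewrite /dot mulr_sumr -sumrB; apply: eq_bigr => e _.
    by rewrite ffunE; ring.
  by rewrite sum_eta; lra.
split=> [e|rho [[rho0 Grho] _]].
  (* A unit vector weighs at most 1 on any set, hence [eta e <= 1]. *)
  rewrite ffunE subr_ge0 -(dot_unit_vec e eta) dotC; apply: reflect => [e'|A _].
    by rewrite ffunE.
  rewrite -dot_indicator dotC dot_unit_vec ffunE.
  by case: (e \in A).
have -> : \sum_e rho e * co_vec eta e = \sum_e rho e - dot eta rho.
  by rewrite -sumrB; apply: eq_bigr => e _; rewrite ffunE; ring.
(* Here [c] is the total of [rho] minus 1, as the complement of [A] has weight at least 1. *)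
rewrite lerBrDr addrC -lerBrDr; apply: reflect => // A AG.
have GcA : family_vec R (compl_family G) (indicator_vec R (~: A)).
  by exists (~: A) => //; apply: imset_f.
have := Grho _ GcA; rewrite -/(dot _ _) dot_indicator (bigID (mem A) predT) /=.
by under eq_bigl => e do rewrite inE; lra.
Qed.

End Adm.

Theorem theorem7p1 (R : realType) (E : finType) (Gamma : {set {set E}}) (k : nat)
    (Gamma_neq0 : Gamma != finset.set0)
    (card_Gamma : forall gamma : {set E}, gamma \in Gamma -> #|gamma| = k)
    (k_gt0 : (0 < k)%N) (k_lt : (k < #|E|)%N)
    (eta eta0 : {ffun E -> R})
    (eta_opt : optimal_density (blocker (family_vec R Gamma)) eta)
    (eta0_opt :
       optimal_density (blocker (family_vec R (compl_family Gamma))) eta0) :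
  eta + eta0 = [ffun=> 1].
Proof.
have card_compl A : A \in compl_family Gamma -> #|A| = (#|E| - k)%N.
  by case/imsetP => B BG ->; rewrite cardsCs finset.setCK card_Gamma.
have complK : compl_family (compl_family Gamma) = Gamma.
  rewrite /compl_family -imset_comp (eq_imset (g := id)) ?imset_id // => A.
  exact: finset.setCK.
have sum_eta := optimal_density_sum k_gt0 card_Gamma eta_opt.
have nk_gt0 : (0 < #|E| - k)%N by rewrite subn_gt0.
have sum_eta0 := optimal_density_sum nk_gt0 card_compl eta0_opt.
have adm_co := Adm_blocker_compl card_Gamma (proj1 eta_opt) sum_eta.
(* Optimality of [eta] against [co_vec eta0] bounds the energy of [co_vec eta] by that of [eta0],
   the constants for masses [k] and [#|E| - k] being opposite. *)
have := Adm_blocker_compl card_compl (proj1 eta0_opt) sum_eta0.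
rewrite complK => /(proj2 eta_opt); rewrite energy2_co_vec sum_eta0.
rewrite natrB ?(ltnW k_lt) // => le_eta.
suff <- : co_vec eta = eta0 by apply/ffunP => e; rewrite !ffunE; ring.
apply: optimal_density_unique eta0_opt adm_co _.
by rewrite energy2_co_vec sum_eta; lra.
Qed.
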